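(* Let $r\ge1$ be a fixed integer, and at each generation $n$ sample $r_n=r$ individuals. Under Assumptions A1, A2 and A3 (and the Kesten–Stigum convergence $\bm Z_n\rho^{-n}\to\bm bW$ a.s. with $W>0$ a.s.), for all $\bm u_1,\dots,\bm u_r\in\mathbb N^l$, $$\mathbb P(\bm X_{n,w}=\bm u_w \text{ for all } w\in\{1,\dots,r\})\to\prod_{w=1}^r p_S(\bm u_w)\quad\text{as } n\to\infty.$$
   Context: Fix an integer $l\ge 2$, let $\mathbb N=\{0,1,2,\dots\}$, and for $\bm x\in\mathbb R^l$ let $|\bm x|=\sum_{i=1}^l|x_i|$. Let $p_1,\dots,p_l$ be probability mass functions on $\mathbb N^l$. The multitype Galton–Watson process $(\bm Z_n)_{n\ge0}$, $\bm Z_n=(Z_{n,1},\dots,Z_{n,l})$, is defined by $\bm Z_0$ equal to a fixed canonical basis vector and $\bm Z_n=\sum_{j=1}^l\sum_{i=1}^{Z_{n-1,j}}\bm Y^{(j)}_{n-1,i}$, where the offspring vectors $\bm Y^{(j)}_{n-1,i}$ are mutually independent and $\bm Y^{(j)}_{n-1,i}$ has law $p_j$; $\bm Y^{(i)}$ denotes a generic vector with law $p_i$. The mean matrix $M$ has entries $M_{ik}=\mathbb E(Y^{(i)}_k)$. Assumption A1: for every $j$, $p_j(\bm 0)=0$ and $\sum_{k=1}^l p_j(\bm e_k)<1$. Assumption A2: $M$ is positively regular and its largest eigenvalue $\rho$ satisfies $\rho>1$; $\bm b=(b_1,\dots,b_l)$ is the left eigenvector for $\rho$ with nonnegative entries and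 $|\bm b|=1$ ($\bm b^TM=\rho\bm b^T$). Sampling: at generation $n$ a sample of $r_n$ individuals is drawn uniformly at random without replacement among the $|\bm Z_n|$ individuals of generation $n$; the $t$-th sampled individual reports $\bm X_{n,t}$, the offspring vector of its parent in generation $n-1$. Assumption A3: (i) $r_n^2\rho^{-n}\to0$; (ii) there is $C$ with $\mathbb E(|\bm Y^{(i)}|^2)\le C$ for all $i$; (iii) there is $K$ with $\mathbb E(|\bm Y^{(i)}|^{-1})\le K$ for all $i$. The size-biased distribution is the probability mass function on $\mathbb N^l$ given by $p_S(\bm u)=\frac{|\bm u|}{\rho}\sum_{i=1}^l b_ip_i(\bm u)$. *)

(* Defs.v *)
From HB Require Import structures.
From mathcomp Require Import all_boot all_order all_algebra.
From mathcomp Require Import all_classical all_reals all_analysis.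
Set Implicit Arguments. Unset Strict Implicit. Unset Printing Implicit Defensive.
Import Order.TTheory GRing.Theory Num.Theory.
Import numFieldNormedType.Exports.
Local Open Scope classical_set_scope.
Local Open Scope ring_scope.

Notation vecN l := {ffun 'I_l -> nat}.

Definition vnorm (l : nat) (u : vecN l) : nat := (\sum_(k < l) u k)%N.

Definition evec (l : nat) (k : 'I_l) : vecN l := [ffun i => nat_of_bool (i == k)].

Definition is_pmf (R : realType) (l : nat) (p : vecN l -> R) : Prop :=
  (forall u, 0 <= p u) /\ (\esum_(u in [set: vecN l]) (p u)%:E = 1)%E.

Definition mean_matrix (R : realType) (l : nat) (p : 'I_l -> vecN l -> R)
  : 'M[R]_l :=
  \matrix_(i < l, k < l) fine (\esum_(u in [set: vecN l]) (p i u * (u k)%:R)%:E).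

Definition mxpow (R : realType) (l : nat) (M : 'M[R]_l) (m : nat) : 'M[R]_l :=
  iter m (fun A => A *m M) 1%:M.

Definition positively_regular (R : realType) (l : nat) (M : 'M[R]_l) : Prop :=
  exists m : nat, forall i k : 'I_l, 0 < mxpow M m i k.

Definition size_biased (R : realType) (l : nat) (p : 'I_l -> vecN l -> R)
  (rho : R) (b : 'rV[R]_l) (u : vecN l) : R :=
  (vnorm u)%:R / rho * \sum_(i < l) b 0 i * p i u.

(* The Galton-Watson process driven by the offspring variables:
   Y n j i w = offspring vector of the i-th individual of type j in generation n. *)
Fixpoint GW_Z (T : Type) (l : nat) (j0 : 'I_l)
  (Y : nat -> 'I_l -> nat -> T -> vecN l) (n : nat) (w : T) : vecN l :=
  match n with
  | 0 => evec j0
  | m.+1 => [ffun k => (\sum_(j < l) \sum_(i < GW_Z j0 Y m w j) Y m j i w k)%N]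
  end.

(* Offspring vector of the parent of each individual of generation n, listed in
   a canonical order of the |Z_n| individuals of generation n: the parent
   (j,i) of generation n-1 has |Y_{n-1,j,i}| children, each reporting
   Y_{n-1,j,i}.  (Generation 0 has no parent; the list is then empty.) *)
Definition parent_reports (T : Type) (l : nat) (j0 : 'I_l)
  (Y : nat -> 'I_l -> nat -> T -> vecN l) (n : nat) (w : T) : seq (vecN l) :=
  match n with
  | 0 => [::]
  | m.+1 => flatten [seq nseq (vnorm (Y m j i w)) (Y m j i w)
                    | j <- enum 'I_l, i <- iota 0 (GW_Z j0 Y m w j)]
  end.

Definition sampled_report (T : Type) (l r : nat) (j0 : 'I_l)
  (Y : nat -> 'I_l -> nat -> T -> vecN l) (sigma : nat -> T -> {ffun 'I_r -> nat})
  (n : nat) (t : 'I_r) (w : T) : vecN l :=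
  nth (evec j0) (parent_reports j0 Y n w) (sigma n w t).

Definition Y_mutually_independent (R : realType) (d : measure_display)
  (T : measurableType d) (P : probability T R) (l : nat)
  (Y : nat -> 'I_l -> nat -> T -> vecN l) : Prop :=
  forall (idx : seq (nat * 'I_l * nat)) (v : nat * 'I_l * nat -> vecN l),
    uniq idx ->
    P (\bigcap_(q in [set q | q \in idx])
         (Y q.1.1 q.1.2 q.2 @^-1` [set v q])) =
    (\prod_(q <- idx) P (Y q.1.1 q.1.2 q.2 @^-1` [set v q]))%E.

Definition Y_cylinder (T : Type) (l : nat) (Y : nat -> 'I_l -> nat -> T -> vecN l)
  (F : seq (nat * 'I_l * nat * vecN l)) : set T :=
  [set w | all (fun q => Y q.1.1.1 q.1.1.2 q.1.2 w == q.2) F].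

(* Sampling at generation n: conditionally on the history up to generation n
   (generated by the cylinder events on generations < n), and given |Z_n| = z
   with z >= r, sigma n is uniformly distributed over the injections of
   {1..r} into the z individuals (sampling without replacement). *)
Definition uniform_sampling (R : realType) (d : measure_display)
  (T : measurableType d) (P : probability T R) (l r : nat) (j0 : 'I_l)
  (Y : nat -> 'I_l -> nat -> T -> vecN l) (sigma : nat -> T -> {ffun 'I_r -> nat})
  : Prop :=
  forall (n : nat) (F : seq (nat * 'I_l * nat * vecN l)) (z : nat)
         (s : {ffun 'I_r -> nat}),
    all (fun q => q.1.1.1 < n)%N F -> (r <= z)%N ->
    let A := Y_cylinder Y F `&` [set w | vnorm (GW_Z j0 Y n w) = z] in
    P (A `&` [set w | sigma n w = s]) =
    (P A * (if injectiveb s && [forall t, s t < z]%N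
            then ((z ^_ r)%:R)^-1 else 0)%:E)%E.

(* Main.v *)
(** Given the history of the process up to generation n, the sample is a
    uniform injection into the list of reports, so the conditional probability
    of the observed values u_1, ..., u_r is a proportion of injections. Since
    |Z_n| tends to infinity, it has the same limit as the product of the
    frequencies of the u_t in that list, and bounded convergence concludes once
    these frequencies converge almost surely to p_S(u_t).

    For the frequency of v, let D be the number of type-j individuals of
    generation n having offspring v, minus Z_{n,j} p_j(v). Given the history,
    D^2 has expectation at most Z_{n,j}, so D^2 / (Z_{n,j} + 1) has expectation
    at most 1 and D^2 / ((Z_{n,j} + 1) rho^n) is almost surely summable in n.
    As Z_{n,j} / rho^n converges, D / rho^n tends to 0 almost surely.

    Histories take countably many values, each of whose fibers is a cylinder
    event; conditioning on the history is integration over these fibers. *)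

Require Import Defs.
From HB Require Import structures.
From mathcomp Require Import all_boot all_order all_algebra.
From mathcomp Require Import all_classical all_reals all_analysis.
From mathcomp Require Import measurable_realfun ring lra.
Import Order.TTheory GRing.Theory Num.Theory.
Import numFieldNormedType.Exports.
Local Open Scope classical_set_scope.
Local Open Scope ring_scope.

Set Implicit Arguments.
Unset Strict Implicit.
Unset Printing Implicit Defensive.

(** * Histories of the process and their cylinder events *)

Definition generation_records (T : Type) (l : nat) (j0 : 'I_l)
  (Y : nat -> 'I_l -> nat -> T -> vecN l) (n : nat) (w : T)
  : seq (nat * 'I_l * nat * vecN l) :=
  [seq (n, j, i, Y n j i w) | j <- enum 'I_l, i <- iota 0 (GW_Z j0 Y n w j)].

(** Encoded as an argument of [Y_cylinder], so that a history is itself the description of the event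
    that it occurs. Its values are sequences over a countable type, hence countably many. *)
Fixpoint history (T : Type) (l : nat) (j0 : 'I_l)
  (Y : nat -> 'I_l -> nat -> T -> vecN l) (n : nat) (w : T)
  : seq (nat * 'I_l * nat * vecN l) :=
  if n is m.+1 then history j0 Y m w ++ generation_records j0 Y m w
  else [::].

(** The cylinder fixes the process generation by generation: equal populations record the same
    individuals, and equal offspring vectors of these give equal next populations. *)
Lemma history_cylinder (T : Type) (l : nat) (j0 : 'I_l)
  (Y : nat -> 'I_l -> nat -> T -> vecN l) (n : nat) (w w' : T) :
  Y_cylinder Y (history j0 Y n w) w' ->
  history j0 Y n w' = history j0 Y n w /\ GW_Z j0 Y n w' = GW_Z j0 Y n w.
Proof.
elim: n => [|n IHn] //=; rewrite /Y_cylinder /= all_cat => /andP[/IHn[-> eqZ]].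
move=> /all_allpairsP gen.
have eqY j i : (i < GW_Z j0 Y n w j)%N -> Y n j i w' = Y n j i w.
  by move=> lti; apply/eqP/(gen j i); rewrite ?mem_enum// mem_iota.
split.
  congr (_ ++ _); rewrite /generation_records eqZ.
  by apply/eq_in_allpairs_dep => j _ i; rewrite mem_iota => /= /eqY ->.
apply/ffunP => k; rewrite !ffunE eqZ; apply: eq_bigr => j _.
by apply: eq_bigr => i _; rewrite eqY.
Qed.

Lemma Y_cylinder_history (T : Type) (l : nat) (j0 : 'I_l)
  (Y : nat -> 'I_l -> nat -> T -> vecN l) (n : nat) (w : T) :
  Y_cylinder Y (history j0 Y n w) w.
Proof.
elim: n => [|n IHn] //=; rewrite /Y_cylinder /= all_cat; apply/andP; split=> //.
by apply/all_allpairsP => j i _ _ /=.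
Qed.

Lemma history_fiber (T : Type) (l : nat) (j0 : 'I_l)
  (Y : nat -> 'I_l -> nat -> T -> vecN l) (n : nat) (w : T) :
  [set w' | history j0 Y n w' = history j0 Y n w] =
  Y_cylinder Y (history j0 Y n w).
Proof.
apply/seteqP; split=> w' /= [eqh]; last by case: (history_cylinder eqh).
by rewrite -eqh; apply: Y_cylinder_history.
Qed.

Lemma history_GW_Z (T : Type) (l : nat) (j0 : 'I_l)
  (Y : nat -> 'I_l -> nat -> T -> vecN l) (n : nat) (w w' : T) :
  history j0 Y n w' = history j0 Y n w -> GW_Z j0 Y n w' = GW_Z j0 Y n w.
Proof.
move=> eqh; apply: (history_cylinder _).2.
by rewrite -eqh; apply: Y_cylinder_history.
Qed.

Lemma history_generation (T : Type) (l : nat) (j0 : 'I_l)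
  (Y : nat -> 'I_l -> nat -> T -> vecN l) (n : nat) (w w' : T) :
  history j0 Y n.+1 w' = history j0 Y n.+1 w ->
  generation_records j0 Y n w' = generation_records j0 Y n w.
Proof.
move=> eqh.
have : Y_cylinder Y (history j0 Y n.+1 w) w'.
  by rewrite -eqh; apply: Y_cylinder_history.
rewrite /Y_cylinder /= all_cat => /andP[cyl].
have [_ eqZ] := history_cylinder cyl.
move=> /all_allpairsP gen; rewrite /generation_records eqZ.
apply/eq_in_allpairs_dep => j _ i ilt; congr (_, _).
by apply/eqP/(gen j i); rewrite ?mem_enum.
Qed.

Lemma parent_reportsS (T : Type) (l : nat) (j0 : 'I_l)
  (Y : nat -> 'I_l -> nat -> T -> vecN l) (n : nat) (w : T) :
  parent_reports j0 Y n.+1 w =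
  flatten [seq nseq (vnorm q.2) q.2 | q <- generation_records j0 Y n w].
Proof. by rewrite /generation_records map_allpairs. Qed.

Lemma history_ltn (T : Type) (l : nat) (j0 : 'I_l)
  (Y : nat -> 'I_l -> nat -> T -> vecN l) (n : nat) (w : T) :
  all (fun q => q.1.1.1 < n)%N (history j0 Y n w).
Proof.
elim: n => [|n IHn] //=; rewrite all_cat; apply/andP; split.
  by apply: sub_all IHn => q /ltnW.
by apply/all_allpairsP => j i _ _ /=.
Qed.

(** Independence yields a product formula only over distinct indices. Old and new records differ in
    the generation, records of one generation in the type or the rank. *)
Lemma uniq_history (T : Type) (l : nat) (j0 : 'I_l)
  (Y : nat -> 'I_l -> nat -> T -> vecN l) (n : nat) (w : T) :
  uniq [seq q.1 | q <- history j0 Y n w].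
Proof.
elim: n => [|n IHn] //=; rewrite map_cat cat_uniq IHn /=; apply/andP; split.
  rewrite map_allpairs; apply/hasPn => q /allpairsPdep[j [i [_ _ ->]]] /=.
  apply/mapP => -[q' /(allP (history_ltn j0 Y n w))/= + eqq].
  by rewrite -eqq ltnn.
rewrite map_allpairs; apply: allpairs_uniq_dep; first exact: enum_uniq.
  by move=> j _; exact: iota_uniq.
by move=> [j i] [j' i'] _ _ /= [-> ->].
Qed.

(** * Size and composition of the list of reports *)

Lemma big_iota0 (V : Type) (idx : V) (op : V -> V -> V) (m : nat) (F : nat -> V) :
  \big[op/idx]_(i <- iota 0 m) F i = \big[op/idx]_(i < m) F i.
Proof. by rewrite -(big_mkord xpredT) /index_iota subn0. Qed.

Lemma size_parent_reports (T : Type) (l : nat) (j0 : 'I_l)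
  (Y : nat -> 'I_l -> nat -> T -> vecN l) (n : nat) (w : T) :
  size (parent_reports j0 Y n.+1 w) = vnorm (GW_Z j0 Y n.+1 w).
Proof.
rewrite parent_reportsS size_flatten /shape -map_comp sumnE big_map.
rewrite big_allpairs_dep /=.
rewrite /vnorm /=; under [RHS]eq_bigr => k _ do rewrite ffunE.
rewrite exchange_big big_enum /=; apply: eq_bigr => j _.
rewrite exchange_big big_iota0.
by apply: eq_bigr => i _; rewrite size_nseq.
Qed.

(** The origin of the size bias: a parent with offspring [v] is reported once by each of its
    [vnorm v] children. *)
Lemma count_parent_reports (T : Type) (l : nat) (j0 : 'I_l)
  (Y : nat -> 'I_l -> nat -> T -> vecN l) (n : nat) (w : T) (v : vecN l) :
  count_mem v (parent_reports j0 Y n.+1 w) =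
  (vnorm v * \sum_(j < l) \sum_(i < GW_Z j0 Y n w j) (Y n j i w == v))%N.
Proof.
rewrite parent_reportsS count_flatten -map_comp sumnE big_map.
rewrite big_allpairs_dep /= big_enum big_distrr /=; apply: eq_bigr => j _.
rewrite big_iota0 big_distrr /=.
apply: eq_bigr => i _; rewrite count_nseq /= mulnC.
by case: eqP => [->|_]; rewrite ?mul1n ?muln1 ?mul0n ?muln0.
Qed.

(** * Measurability and integration over countably many fibers *)

Lemma measurable_saturated (d : measure_display) (T : measurableType d)
  (I : countType) (X : T -> I) (A : set T) :
  (forall w, measurable [set w' | X w' = X w]) ->
  (forall w w', X w' = X w -> A w -> A w') -> measurable A.
Proof.
move=> mX satA.
(* By saturation each piece is either empty or a whole fiber of [X]. *)
pose E k := [set w' | A w' /\ pickle (X w') = k].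
have -> : A = \bigcup_k E k.
  by apply/seteqP; split=> [w Aw|w [k _ []//]]; exists (pickle (X w)).
apply: bigcupT_measurable => k.
have [[w [Aw Xw]]|noE] := pselect (exists w, E k w).
  suff -> : E k = [set w' | X w' = X w] by exact: mX.
  apply/seteqP; split=> w' /=.
    by case=> _ Xw'; apply: (pcan_inj pickleK); rewrite Xw Xw'.
  by move=> eqX; split; [exact: satA eqX Aw|rewrite eqX].
suff -> : E k = set0 by exact: measurable0.
by apply/seteqP; split=> // w' Ew'; case: noE; exists w'.
Qed.

Lemma measurable_fun_factor (d d' : measure_display) (T : measurableType d)
  (U : measurableType d') (I : countType) (X : T -> I) (f : T -> U) :
  (forall w, measurable [set w' | X w' = X w]) ->
  (forall w w', X w' = X w -> f w' = f w) -> measurable_fun setT f.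
Proof.
move=> mX fX _ B mB; rewrite setTI; apply: (measurable_saturated mX) => w w' /fX.
by rewrite /preimage /= => ->.
Qed.

(** Plays the part of the tower property: the fibers partition the space into countably many
    measurable sets, and nonnegative integrals add up over them. *)
Lemma ge0_le_integral_fibers (d : measure_display) (T : measurableType d)
  (R : realType) (mu : {measure set T -> \bar R}) (I : countType) (X : T -> I)
  (f g : T -> \bar R) :
  (forall w, measurable [set w' | X w' = X w]) ->
  measurable_fun setT f -> measurable_fun setT g ->
  (forall w, 0 <= f w)%E -> (forall w, 0 <= g w)%E ->
  (forall w, \int[mu]_(x in [set w' | X w' = X w]) f x <=
             \int[mu]_(x in [set w' | X w' = X w]) g x)%E ->
  (\int[mu]_x f x <= \int[mu]_x g x)%E.
Proof.
move=> mX mf mg f0 g0 lefg.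
pose E k := [set w' | pickle (X w') = k].
have mE k : measurable (E k).
  by apply: (measurable_saturated mX) => w w' /=; rewrite /E /= => ->.
have UE : setT = \bigcup_k E k.
  by apply/seteqP; split=> // w _; exists (pickle (X w)).
have tE : trivIset setT E.
  apply/trivIsetP => i k _ _ /eqP neq; apply/seteqP; split=> // w [/= Ei Ek].
  by case: neq; rewrite -Ei -Ek.
have intE h : measurable_fun setT h -> (forall w, 0 <= h w)%E ->
    (\int[mu]_x h x = \sum_(0 <= k <oo) \int[mu]_(x in E k) h x)%E.
  by move=> mh h0; rewrite UE ge0_integral_bigcup// -UE.
rewrite !intE//; apply: lee_nneseries => [k _ _|k _].
  by apply: integral_ge0 => w _; exact: f0.
have [[w Xw]|noE] := pselect (exists w, E k w).
  suff -> : E k = [set w' | X w' = X w] by exact: lefg.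
  apply/seteqP; split=> w' /=; last by move=> eqX; rewrite /E /= eqX.
  by move=> Xw'; apply: (pcan_inj pickleK); rewrite Xw Xw'.
suff -> : E k = set0 by rewrite !integral_set0.
by apply/seteqP; split=> // w' Ew'; case: noE; exists w'.
Qed.

(** * Second moments of centered counts *)

(** Given [A], the events [G i] have probability [p] and are pairwise independent. The cross terms
    of the square therefore vanish, and each diagonal term is [p * (1 - p)] times [P A]. *)
Lemma integral_centered_square (d : measure_display) (T : measurableType d)
  (R : realType) (P : probability T R) (A : set T) (G : nat -> set T) (p : R)
  (m : nat) :
  measurable A -> (forall i, measurable (G i)) -> 0 <= p <= 1 ->
  (forall i, P (G i `&` A) = (p%:E * P A)%E) ->
  (forall i k, i != k -> P (G i `&` G k `&` A) = ((p ^+ 2)%:E * P A)%E) ->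
  (\int[P]_(x in A) ((\sum_(i < m) (\1_(G i) x - p)) ^+ 2)%:E <=
     m%:R%:E * P A)%E.
Proof.
move=> mA mG /andP[p0 p1] PG PGG.
have PA : P A \is a fin_num by exact: fin_num_measure.
have ind U : measurable U -> P.-integrable A (fun x => (\1_U x)%:E).
  move=> mU; apply: (integrableS measurableT) => //; exact: integrable_indic.
have intind U : measurable U -> 
    (\int[P]_(x in A) (\1_U x)%:E = P (U `&` A))%E.
  exact: integral_indic.
have int1 i k : P.-integrable A
    (fun x => ((\1_(G i) x - p) * (\1_(G k) x - p) : R)%:E).
  apply: measurable_bounded_integrable => //.
  - by rewrite ltey_eq PA.
  - by apply: measurable_funM; apply: measurable_funB => //;
      apply: measurable_funTS; exact: measurable_indic.
  - exists 1; split; first exact: num_real.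
    move=> M M1 x _ /=; apply: le_trans (ltW M1); rewrite normrM.
    have bd j : `|\1_(G j) x - p| <= 1 :> R.
      rewrite indicE; case: (x \in G j) => /=; rewrite ler_norml;
        apply/andP; split; rewrite ?mulr1n ?mulr0n; move: p0 p1; lra.
    by rewrite -[leRHS]mulr1; apply: ler_pM => //; exact: bd.
(* Stated for all [i] and [k], so that it serves both the diagonal and the cross terms. *)
have val i k : (\int[P]_(x in A) ((\1_(G i) x - p) * (\1_(G k) x - p))%:E =
   P (G i `&` G k `&` A) - (p ^+ 2)%:E * P A)%E.
  under eq_integral => x _.
    rewrite (_ : _ * _ = \1_(G i `&` G k) x - p * \1_(G i) x
      - p * \1_(G k) x + p ^+ 2 * \1_setT x); last first.
      by rewrite indicI /= indicT mulr1 expr2; ring.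
    rewrite EFinD !EFinB !EFinM; over.
  have indM q U : measurable U -> P.-integrable A (fun x => q%:E * (\1_U x)%:E)%E.
    by move=> mU; apply: integrableZl => //; exact: ind.
  have mI := measurableI _ _ (mG i) (mG k).
  rewrite integralD//; last 2 first.
  - apply: integrableB => //; last exact: indM.
    by apply: integrableB => //; [exact: ind|exact: indM].
  - exact: indM.
  rewrite integralB//; last 2 first.
  - by apply: integrableB => //; [exact: ind|exact: indM].
  - exact: indM.
  rewrite integralB//; [|exact: ind|exact: indM].
  rewrite !integralZl//; [|exact: ind..].
  rewrite !intind// setTI !PG.
  rewrite -(fineK PA) -(fineK (fin_num_measure P _ (measurableI _ _ mI mA))).
  by rewrite -!EFinM -!EFinD; congr EFin; ring.
under eq_integral => x _.
  rewrite expr2 big_distrl /=.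
  under eq_bigr => i _ do rewrite big_distrr /=.
  rewrite -sumEFin; under eq_bigr => i _ do rewrite -sumEFin; over.
rewrite integral_sum//; last by move=> i; apply: integrable_sum => // k _.
have -> : (m%:R%:E * P A = \sum_(i < m) P A)%E.
  by rewrite -(fineK PA) sumEFin sumr_const card_ord -EFinM mulr_natl.
apply: lee_sum => i _; rewrite integral_sum// (bigD1 i)//= big1 ?adde0.
  rewrite val setIid PG -(fineK PA) -!EFinM -EFinB lee_fin.
  have : 0 <= fine (P A) by exact: fine_ge0.
  by nra.
move=> k ki; rewrite val PGG 1?eq_sym// subee// fin_numM//.
Qed.

(** * Probabilities of cylinder events *)

(** Turns a list of records into the function from indices to values that [Y_mutually_independent]
    expects; a repeated key could carry two different values. *)
Lemma uniq_keys_lookup (K V : eqType) (v0 : V) (F : seq (K * V)) :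
  uniq [seq q.1 | q <- F] -> exists v : K -> V, {in F, forall q, v q.1 = q.2}.
Proof.
elim: F => [_|q F IHF /= /andP[qF /IHF[v vF]]]; first by exists (fun=> v0).
exists (fun k => if k == q.1 then q.2 else v k) => q'.
rewrite inE => /predU1P[->|q'F]; first by rewrite eqxx.
case: eqP => [eqq|_]; last exact: vF.
by rewrite -eqq map_f in qF.
Qed.

Lemma Y_cylinder_cons (T : Type) (l : nat) (Y : nat -> 'I_l -> nat -> T -> vecN l)
  (n : nat) (j : 'I_l) (i : nat) (v : vecN l) (F : seq (nat * 'I_l * nat * vecN l)) :
  Y_cylinder Y ((n, j, i, v) :: F) = Y n j i @^-1` [set v] `&` Y_cylinder Y F.
Proof.
apply/seteqP; split=> w; rewrite /Y_cylinder /=; first by move=> /andP[/eqP].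
by move=> [/eqP ->].
Qed.

Lemma measurable_cylinder (d : measure_display) (T : measurableType d) (l : nat)
  (Y : nat -> 'I_l -> nat -> T -> vecN l) (F : seq (nat * 'I_l * nat * vecN l)) :
  (forall n j i u, measurable (Y n j i @^-1` [set u])) ->
  measurable (Y_cylinder Y F).
Proof.
move=> mY; elim: F => [|[[[n j] i] v] F IHF].
  rewrite (_ : Y_cylinder Y [::] = setT); first exact: measurableT.
  by apply/seteqP; split.
by rewrite Y_cylinder_cons; apply: measurableI.
Qed.

Lemma measurable_history (d : measure_display) (T : measurableType d) (l : nat)
  (j0 : 'I_l) (Y : nat -> 'I_l -> nat -> T -> vecN l) (n : nat) (w : T) :
  (forall n j i u, measurable (Y n j i @^-1` [set u])) ->
  measurable [set w' | history j0 Y n w' = history j0 Y n w].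
Proof. by move=> mY; rewrite history_fiber; apply: measurable_cylinder. Qed.

Lemma cylinder_prob (R : realType) (d : measure_display) (T : measurableType d)
  (P : probability T R) (l : nat) (p : 'I_l -> vecN l -> R)
  (Y : nat -> 'I_l -> nat -> T -> vecN l) (F : seq (nat * 'I_l * nat * vecN l)) :
  (forall n j i u, P (Y n j i @^-1` [set u]) = (p j u)%:E) ->
  Y_mutually_independent P Y ->
  uniq [seq q.1 | q <- F] ->
  P (Y_cylinder Y F) = (\prod_(q <- F) p q.1.1.2 q.2)%:E.
Proof.
move=> lawY indY uF.
have [v vF] := uniq_keys_lookup [ffun=> 0%N] uF.
have -> : Y_cylinder Y F = \bigcap_(q in [set q | q \in [seq q.1 | q <- F]])
    (Y q.1.1 q.1.2 q.2 @^-1` [set v q]).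
  apply/seteqP; split=> w /=.
    move=> /allP cyl q /mapP[x xF ->] /=.
    by rewrite (vF _ xF); apply/eqP/cyl.
  by move=> cap; apply/allP => x xF; rewrite -(vF _ xF); apply/eqP/cap/map_f.
rewrite indY// big_map -prodEFin big_seq [RHS]big_seq.
by apply: eq_bigr => q qF; rewrite lawY vF.
Qed.

Lemma cylinder_prob_cons (R : realType) (d : measure_display)
  (T : measurableType d) (P : probability T R) (l : nat)
  (p : 'I_l -> vecN l -> R) (Y : nat -> 'I_l -> nat -> T -> vecN l)
  (n : nat) (j : 'I_l) (i : nat) (v : vecN l)
  (F : seq (nat * 'I_l * nat * vecN l)) :
  (forall n j i u, P (Y n j i @^-1` [set u]) = (p j u)%:E) ->
  Y_mutually_independent P Y ->
  (n, j, i) \notin [seq q.1 | q <- F] -> uniq [seq q.1 | q <- F] ->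
  P (Y n j i @^-1` [set v] `&` Y_cylinder Y F) =
  ((p j v)%:E * P (Y_cylinder Y F))%E.
Proof.
move=> lawY indY notin uF; rewrite -Y_cylinder_cons !(cylinder_prob lawY)//=.
  by rewrite big_cons EFinM.
by rewrite notin.
Qed.

(** * Deviations of the offspring counts from their conditional means *)

Definition deviation (R : realType) (T : Type) (l : nat) (j0 : 'I_l)
  (p : 'I_l -> vecN l -> R) (Y : nat -> 'I_l -> nat -> T -> vecN l)
  (n : nat) (j : 'I_l) (v : vecN l) (w : T) : R :=
  \sum_(i < GW_Z j0 Y n w j) ((Y n j i w == v)%:R - p j v).

(** The deviation looks at the offspring of generation [n], which are recorded only in the history
    up to [n.+1]. *)
Lemma deviation_history (R : realType) (T : Type) (l : nat) (j0 : 'I_l)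
  (p : 'I_l -> vecN l -> R) (Y : nat -> 'I_l -> nat -> T -> vecN l)
  (n : nat) (j : 'I_l) (v : vecN l) (w w' : T) :
  history j0 Y n.+1 w' = history j0 Y n.+1 w ->
  GW_Z j0 Y n w' = GW_Z j0 Y n w /\
  deviation j0 p Y n j v w' = deviation j0 p Y n j v w.
Proof.
move=> eqh.
have cyl : Y_cylinder Y (history j0 Y n w ++ generation_records j0 Y n w) w'.
  by rewrite -[_ ++ _]/(history j0 Y n.+1 w) -eqh; apply: Y_cylinder_history.
move: cyl; rewrite /Y_cylinder /= all_cat => /andP[cyl].
have [_ eqZ] := history_cylinder cyl.
move=> /all_allpairsP gen; split=> //; rewrite /deviation eqZ.
apply: eq_bigr => i _; congr ((_ == _)%:R - _).
by apply/eqP/(gen j i); rewrite ?mem_enum ?mem_iota//=.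
Qed.

Lemma integral_deviation (R : realType) (d : measure_display)
  (T : measurableType d) (P : probability T R) (l : nat) (j0 : 'I_l)
  (p : 'I_l -> vecN l -> R) (Y : nat -> 'I_l -> nat -> T -> vecN l)
  (n : nat) (j : 'I_l) (v : vecN l) :
  (forall n j i u, measurable (Y n j i @^-1` [set u])) ->
  (forall n j i u, P (Y n j i @^-1` [set u]) = (p j u)%:E) ->
  Y_mutually_independent P Y ->
  (\int[P]_w (deviation j0 p Y n j v w ^+ 2 / (GW_Z j0 Y n w j).+1%:R)%:E <= 1)%E.
Proof.
move=> mY lawY indY.
have p01 : 0 <= p j v <= 1.
  by rewrite -!lee_fin -(lawY 0%N j 0%N) measure_ge0 probability_le1.
have dev0 w : (0 <= (deviation j0 p Y n j v w ^+ 2 / (GW_Z j0 Y n w j).+1%:R)%:E)%E.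
  by rewrite lee_fin divr_ge0// sqr_ge0.
(* The bound 1 becomes an integral, so that the two sides can be compared fiber by fiber. *)
have <- : (\int[P]_w cst 1 w = 1)%E.
  by rewrite integral_cst// mul1e; exact: probability_setT.
(* Conditioning stops at [n]: the population of generation [n] is then constant on each fiber, while
   its offspring are still random. *)
apply: (ge0_le_integral_fibers (X := history j0 Y n)) => // [w||w].
- exact: measurable_history.
- apply: (measurable_fun_factor (X := history j0 Y n.+1)).
    by move=> w; exact: measurable_history.
  by move=> w w' eqh; have [-> ->] := deviation_history p j v eqh.
set A := [set w' | _]; have mA : measurable A by exact: measurable_history.
set z := GW_Z j0 Y n w j.
have AE : A = Y_cylinder Y (history j0 Y n w) by exact: history_fiber.
have notin j' i : (n, j', i) \notin [seq q.1 | q <- history j0 Y n w].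
  by apply/mapP => -[q /(allP (history_ltn j0 Y n w)) + eqq]; rewrite -eqq ltnn.
have uH := uniq_history j0 Y n w.
pose G i := Y n j i @^-1` [set v].
have square : (\int[P]_(x in A) ((\sum_(i < z) (\1_(G i) x - p j v)) ^+ 2)%:E <=
     z%:R%:E * P A)%E.
  apply: integral_centered_square => // [i|i|i k ik]; first exact: mY.
    by rewrite AE; apply: cylinder_prob_cons.
  (* The two fresh indices are peeled off one after the other, each giving a factor [p j v];
     [i != k] keeps the first fresh with respect to the second. *)
  rewrite -setIA AE -[G k `&` _]Y_cylinder_cons.
  rewrite (cylinder_prob_cons _ lawY)//=; last 2 first.
  - by rewrite inE negb_or notin andbT; apply: contra ik => /eqP[->].
  - by rewrite notin uH.
  rewrite Y_cylinder_cons (cylinder_prob_cons _ lawY)//.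
  by rewrite muleA -EFinM -expr2.
have -> : (\int[P]_(x in A)
    (deviation j0 p Y n j v x ^+ 2 / (GW_Z j0 Y n x j).+1%:R)%:E =
    \int[P]_(x in A) (((z.+1)%:R^-1)%:E *
      ((\sum_(i < z) (\1_(G i) x - p j v)) ^+ 2)%:E))%E.
  apply: eq_integral => x; rewrite inE => eqh; have Zx := history_GW_Z eqh.
  rewrite /deviation Zx -/z -EFinM mulrC; congr ((_ * _ ^+ 2)%:E).
  apply: eq_bigr => i _; rewrite indicE; congr (_ - _); congr (_ %:R).
  by congr nat_of_bool; apply/eqP/idP; rewrite inE.
have msum : measurable_fun A
    (fun x => ((\sum_(i < z) (\1_(G i) x - p j v)) ^+ 2)%:E : \bar R).
  apply/measurable_EFinP; apply: measurable_funX.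
  apply: measurable_sum => i; apply: measurable_funB => //.
  by apply: measurable_funTS; apply: measurable_indic; exact: mY.
rewrite ge0_integralZl//; last by move=> x _; rewrite lee_fin sqr_ge0.
rewrite integral_cst// mul1e.
apply: (@le_trans _ _ ((z.+1)%:R^-1%:E * (z%:R%:E * P A))%E).
  by rewrite lee_pmul2l// lte_fin invr_gt0.
rewrite muleA -EFinM; apply: gee_pMl => //.
  by rewrite lee_fin ler_pdivrMl// mulr1 ler_nat.
Qed.

(** By monotone convergence the sum of the series has a finite integral, so it is finite almost
    everywhere, and the terms of a convergent series tend to 0. *)
Lemma ae_cvg0_summable (d : measure_display) (T : measurableType d)
  (R : realType) (mu : {measure set T -> \bar R}) (f : nat -> T -> R) :
  (forall n, measurable_fun setT (f n)) -> (forall n w, 0 <= f n w) ->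
  (\sum_(0 <= n <oo) \int[mu]_w (f n w)%:E < +oo)%E ->
  {ae mu, forall w, f n w @[n --> \oo] --> 0}.
Proof.
move=> mf f0 fin.
have mfE n : measurable_fun setT (fun w => (f n w)%:E : \bar R).
  by apply/measurable_EFinP.
have f0E n w : setT w -> (0 <= (f n w)%:E)%E by rewrite lee_fin.
pose g w := (\sum_(0 <= n <oo) (f n w)%:E)%E.
have g0 w : (0 <= g w)%E by apply: nneseries_ge0 => n _ _; exact: f0E.
have intg : mu.-integrable setT g.
  apply/integrableP; split.
    by apply: (ge0_emeasurable_sum (P := xpredT)) => // n w _ _; exact: f0E.
  under eq_integral => w _ do rewrite gee0_abs//.
  by rewrite integral_nneseries.
have := integrable_ae measurableT intg; apply: filterS => w /(_ I) gfin.
apply: cvg_series_cvg_0; apply: nnseries_is_cvg => [n|]; first exact: f0.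
by move: gfin; rewrite ge0_fin_numE.
Qed.

Lemma cvg_inv_expn (R : realType) (rho : R) :
  1 < rho -> (rho ^+ n)^-1 @[n --> \oo] --> 0.
Proof.
move=> rho1; rewrite (_ : (fun n => (rho ^+ n)^-1) = GRing.exp rho^-1); last first.
  by apply/funext => n; rewrite exprVn.
have rho0 : 0 < rho by exact: lt_trans rho1.
by apply: cvg_expr; rewrite ger0_norm ?invr_ge0 ?invf_lt1// ltW.
Qed.

Lemma deviation_cvg0 (R : realType) (d : measure_display)
  (T : measurableType d) (P : probability T R) (l : nat) (j0 : 'I_l)
  (p : 'I_l -> vecN l -> R) (Y : nat -> 'I_l -> nat -> T -> vecN l)
  (rho : R) (j : 'I_l) (v : vecN l) :
  (forall n j i u, measurable (Y n j i @^-1` [set u])) ->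
  (forall n j i u, P (Y n j i @^-1` [set u]) = (p j u)%:E) ->
  Y_mutually_independent P Y -> 1 < rho ->
  {ae P, forall w, deviation j0 p Y n j v w ^+ 2 / (GW_Z j0 Y n w j).+1%:R
    / rho ^+ n @[n --> \oo] --> 0}.
Proof.
move=> mY lawY indY rho1.
have rho0 : 0 < rho by exact: lt_trans rho1.
have mdev n : measurable_fun setT
    (fun w => deviation j0 p Y n j v w ^+ 2 / (GW_Z j0 Y n w j).+1%:R).
  apply: (measurable_fun_factor (X := history j0 Y n.+1)).
    by move=> w; exact: measurable_history.
  by move=> w w' eqh; have [-> ->] := deviation_history p j v eqh.
have dev0 n w : 0 <= deviation j0 p Y n j v w ^+ 2 / (GW_Z j0 Y n w j).+1%:R.
  by rewrite divr_ge0// sqr_ge0.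
apply: ae_cvg0_summable => [n|n w|].
- by apply: measurable_funM.
- by rewrite mulr_ge0// invr_ge0 exprn_ge0// ltW.
(* The expectations without the factor [rho ^+ n] are at most 1, which leaves a geometric series of
   ratio [rho^-1]. *)
apply: (@le_lt_trans _ _ (\sum_(0 <= n <oo) ((rho^-1) ^+ n)%:E)%E).
  apply: lee_nneseries => [n _ _|n _].
    by apply: integral_ge0 => w _; rewrite lee_fin mulr_ge0// invr_ge0 exprn_ge0// ltW.
  under eq_integral => w _ do rewrite EFinM.
  rewrite ge0_integralZr//; last 3 first.
  - exact/measurable_EFinP.
  - by move=> w _; rewrite lee_fin.
  - by rewrite lee_fin invr_ge0 exprn_ge0// ltW.
  rewrite -[leRHS]mul1e exprVn; apply: lee_wpmul2r.
    by rewrite lee_fin invr_ge0 exprn_ge0// ltW.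
  exact: integral_deviation.
have inv_lt1 : `|rho^-1| < 1.
  by rewrite ger0_norm ?invr_ge0 ?invf_lt1// ltW.
have /cvgP := cvg_geometric_series (a := 1) inv_lt1.
rewrite -exprn_geometric => cvgs.
have := EFin_lim cvgs.
rewrite (_ : EFin \o _ = (fun n => \sum_(0 <= k < n) ((rho^-1) ^+ k)%:E)%E).
  by move=> ->; rewrite ltry.
by apply/funext => n /=; rewrite sumEFin.
Qed.

(** * Limits of population sizes and report frequencies *)

Lemma cvg_sumr (R : realType) (I : finType) (f : I -> nat -> R) (a : I -> R) :
  (forall i, f i n @[n --> \oo] --> a i) ->
  \sum_i f i n @[n --> \oo] --> \sum_i a i.
Proof. by move=> fa; apply: cvg_big => // ; exact: add_continuous. Qed.

Lemma cvg_prodr (R : realType) (I : finType) (f : I -> nat -> R) (a : I -> R) :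
  (forall i, f i n @[n --> \oo] --> a i) ->
  \prod_i f i n @[n --> \oo] --> \prod_i a i.
Proof. by move=> fa; apply: cvg_big => // ; exact: mul_continuous. Qed.

Lemma cvg0_sqr (R : realType) (f : nat -> R) :
  f n ^+ 2 @[n --> \oo] --> 0 -> f n @[n --> \oo] --> 0.
Proof.
move=> f0; apply: norm_cvg0.
under eq_cvg => n do rewrite -sqrtr_sqr.
suff : Num.sqrt (f n ^+ 2) @[n --> \oo] --> Num.sqrt (0 : R) by rewrite sqrtr0.
by apply: cvg_comp; [exact: f0|exact: sqrt_continuous].
Qed.

Lemma deviation_rate (R : realType) (T : Type) (l : nat) (j0 : 'I_l)
  (p : 'I_l -> vecN l -> R) (Y : nat -> 'I_l -> nat -> T -> vecN l)
  (rho a : R) (j : 'I_l) (v : vecN l) (w : T) :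
  1 < rho ->
  deviation j0 p Y n j v w ^+ 2 / (GW_Z j0 Y n w j).+1%:R / rho ^+ n
    @[n --> \oo] --> 0 ->
  (GW_Z j0 Y n w j)%:R / rho ^+ n @[n --> \oo] --> a ->
  deviation j0 p Y n j v w / rho ^+ n @[n --> \oo] --> 0.
Proof.
move=> rho1 dev0 Za; apply: cvg0_sqr.
have rho0 : 0 < rho by exact: lt_trans rho1.
(* The square splits into the quantity known to vanish and the factor (Z + 1) / rho^n, which
   converges; the latter restores the normalization by Z + 1. *)
have -> : (fun n => (deviation j0 p Y n j v w / rho ^+ n) ^+ 2) =
    (fun n => deviation j0 p Y n j v w ^+ 2 / (GW_Z j0 Y n w j).+1%:R / rho ^+ n
      * ((GW_Z j0 Y n w j)%:R / rho ^+ n + (rho ^+ n)^-1)).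
  apply/funext => n; have ? : rho ^+ n != 0 by rewrite expf_neq0 ?gt_eqF.
  rewrite -[in RHS]natr1; field.
  by rewrite natr1 pnatr_eq0 andbT.
rewrite -(mul0r (a + 0)); apply: cvgM => //.
by apply: cvgD => //; exact: cvg_inv_expn.
Qed.

Lemma count_parent_reports_deviation (R : realType) (T : Type) (l : nat)
  (j0 : 'I_l) (p : 'I_l -> vecN l -> R)
  (Y : nat -> 'I_l -> nat -> T -> vecN l) (n : nat) (w : T) (v : vecN l) :
  (count_mem v (parent_reports j0 Y n.+1 w))%:R =
  (vnorm v)%:R * \sum_(j < l)
    (deviation j0 p Y n j v w + (GW_Z j0 Y n w j)%:R * p j v) :> R.
Proof.
rewrite count_parent_reports natrM; congr (_ * _); rewrite natr_sum.
apply: eq_bigr => j _; rewrite /deviation sumrB sumr_const card_ord natr_sum.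
by rewrite mulr_natl subrK.
Qed.

Lemma cvg_vnorm_rate (R : realType) (l : nat) (Z : nat -> vecN l)
  (rho c : R) (b : 'rV[R]_l) :
  \sum_(i < l) b 0 i = 1 ->
  (forall k, (Z n k)%:R / rho ^+ n @[n --> \oo] --> b 0 k * c) ->
  (vnorm (Z n))%:R / rho ^+ n @[n --> \oo] --> c.
Proof.
move=> b1 Zb; have -> : c = \sum_k b 0 k * c by rewrite -mulr_suml b1 mul1r.
have -> : (fun n => (vnorm (Z n))%:R / rho ^+ n) =
    (fun n => \sum_(k < l) (Z n k)%:R / rho ^+ n).
  by apply/funext => n; rewrite natr_sum mulr_suml.
by apply: cvg_sumr => k; exact: Zb.
Qed.

Lemma cvg_vnorm_pinfty (R : realType) (l : nat) (Z : nat -> vecN l)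
  (rho c : R) :
  1 < rho -> 0 < c -> (vnorm (Z n))%:R / rho ^+ n @[n --> \oo] --> c ->
  (vnorm (Z n))%:R @[n --> \oo] --> (+oo : set_system R).
Proof.
move=> rho1 c0 Zc; have rho0 : 0 < rho by exact: lt_trans rho1.
have Zpos : \forall n \near \oo, 0 < (vnorm (Z n))%:R :> R.
  near=> n.
  have : 0 < (vnorm (Z n))%:R / rho ^+ n by near: n; exact: cvgr_gt Zc _ c0.
  by rewrite pmulr_lgt0// invr_gt0 exprn_gt0.
apply/(gtr0_cvgV0 Zpos).
(* Divergence is read off the inverse, a product of a factor tending to [c^-1] and a factor tending
   to 0. *)
have -> : unstable.inv_fun (fun n => (vnorm (Z n))%:R : R) =
    (fun n => ((vnorm (Z n))%:R / rho ^+ n)^-1 * (rho ^+ n)^-1).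
  apply/funext => n; rewrite invfM invrK -mulrA mulfV ?mulr1//.
  by rewrite expf_neq0 ?gt_eqF.
rewrite -(mulr0 c^-1); apply: cvgM; last exact: cvg_inv_expn.
by apply: cvgV => //; rewrite gt_eqF.
Unshelve. all: by end_near.
Qed.

Lemma report_frequency_cvg (R : realType) (T : Type) (l : nat) (j0 : 'I_l)
  (p : 'I_l -> vecN l -> R) (Y : nat -> 'I_l -> nat -> T -> vecN l)
  (rho c : R) (b : 'rV[R]_l) (v : vecN l) (w : T) :
  1 < rho -> 0 < c -> \sum_(i < l) b 0 i = 1 ->
  (forall j, deviation j0 p Y n j v w ^+ 2 / (GW_Z j0 Y n w j).+1%:R / rho ^+ n
    @[n --> \oo] --> 0) ->
  (forall k, (GW_Z j0 Y n w k)%:R / rho ^+ n @[n --> \oo] --> b 0 k * c) ->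
  (count_mem v (parent_reports j0 Y n.+1 w))%:R /
    (vnorm (GW_Z j0 Y n.+1 w))%:R @[n --> \oo] --> size_biased p rho b v.
Proof.
move=> rho1 c0 b1 dev0 Zb; have rho0 : 0 < rho by exact: lt_trans rho1.
have rhoX n : rho ^+ n != 0 by rewrite expf_neq0 ?gt_eqF.
have Zc := cvg_vnorm_rate b1 Zb.
have ZSc : (vnorm (GW_Z j0 Y n.+1 w))%:R / rho ^+ n.+1 @[n --> \oo] --> c.
  by move: Zc; rewrite -cvg_shiftS.
(* [F] is the count at the scale of generation [n], whereas the list has the size of generation
   [n.+1]. This shift is the factor [1 / rho] in [size_biased]; the random limit [c] cancels. *)
pose F n := (vnorm v)%:R * \sum_(j < l) (deviation j0 p Y n j v w / rho ^+ n
  + (GW_Z j0 Y n w j)%:R / rho ^+ n * p j v).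
have -> : (fun n => (count_mem v (parent_reports j0 Y n.+1 w))%:R /
      (vnorm (GW_Z j0 Y n.+1 w))%:R) =
    (fun n => F n * ((vnorm (GW_Z j0 Y n.+1 w))%:R / rho ^+ n.+1)^-1 / rho).
  apply/funext => n; rewrite (count_parent_reports_deviation j0 p Y).
  have -> : F n = (vnorm v)%:R * (\sum_(j < l) (deviation j0 p Y n j v w
      + (GW_Z j0 Y n w j)%:R * p j v)) / rho ^+ n.
    rewrite /F -mulrA mulr_suml; congr (_ * _); apply: eq_bigr => j _.
    by rewrite mulrDl mulrAC.
  rewrite invfM invrK exprS; set S := _ * \sum_j _; set V := _^-1.
  by field; rewrite rhoX gt_eqF.
have -> : size_biased p rho b v =
    (vnorm v)%:R * (\sum_(j < l) (0 + b 0 j * c * p j v)) * c^-1 / rho.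
  rewrite /size_biased; under [in RHS]eq_bigr => j _ do rewrite add0r mulrAC.
  by rewrite -mulr_suml; field; rewrite !gt_eqF.
apply: cvgM; last exact: cvg_cst.
apply: cvgM; last by apply: cvgV => //; rewrite gt_eqF.
apply: cvgM; first exact: cvg_cst.
apply: cvg_sumr => j; apply: cvgD.
  exact: deviation_rate rho1 (dev0 j) (Zb j).
by apply: cvgM; [exact: Zb|exact: cvg_cst].
Qed.

(** * Counting samples with prescribed values *)

(** A sample chooses positions rather than values, so individuals with equal reports stay
    distinct. *)
Definition injective_samples (V : eqType) (x0 : V) (L : seq V) (r : nat)
  (u : 'I_r -> V) : {set {ffun 'I_r -> 'I_(size L)}} :=
  [set s : {ffun 'I_r -> 'I_(size L)} |
    injectiveb s & [forall t, nth x0 L (s t) == u t]]%SET.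

Lemma card_nth_eq (V : eqType) (x0 v : V) (L : seq V) :
  #|[pred i : 'I_(size L) | nth x0 L i == v]| = count_mem v L.
Proof. by rewrite -sum1_card -sum1_count (big_nth x0) big_mkord. Qed.

Lemma card_samples (V : eqType) (x0 : V) (L : seq V) (r : nat) (u : 'I_r -> V) :
  #|[set s : {ffun 'I_r -> 'I_(size L)} | [forall t, nth x0 L (s t) == u t]]%SET|
  = (\prod_(t < r) count_mem (u t) L)%N.
Proof.
pose F t := [pred i : 'I_(size L) | nth x0 L i == u t].
rewrite (_ : #|_| = #|(family F : simpl_pred {ffun 'I_r -> 'I_(size L)})|).
  rewrite card_family foldrE big_image /=.
  by apply: eq_bigr => t _; exact: card_nth_eq.
by apply: eq_card => s; rewrite inE; apply/forallP/familyP.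
Qed.

Lemma injective_samples_le (V : eqType) (x0 : V) (L : seq V) (r : nat)
  (u : 'I_r -> V) :
  (#|injective_samples x0 L u| <= \prod_(t < r) count_mem (u t) L)%N.
Proof.
rewrite -(card_samples x0); apply/subset_leq_card/fintype.subsetP => s.
by rewrite !inE => /andP[].
Qed.

(** Inclusion-exclusion for the samples with the right values and the injective samples, whose union
    is bounded by the set of all samples. The additive form avoids truncated subtraction. *)
Lemma injective_samples_ge (V : eqType) (x0 : V) (L : seq V) (r : nat)
  (u : 'I_r -> V) :
  (\prod_(t < r) count_mem (u t) L + size L ^_ r <=
   #|injective_samples x0 L u| + size L ^ r)%N.
Proof.
have cardI : #|[set s : {ffun 'I_r -> 'I_(size L)} | injectiveb s]%SET| = size L ^_ r.
  by rewrite card_inj_ffuns !card_ord.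
have cardF : #|{ffun 'I_r -> 'I_(size L)}| = (size L ^ r)%N.
  by rewrite card_ffun !card_ord.
rewrite -(card_samples x0) -cardI -cardF -cardsUI [leqRHS]addnC.
apply: leq_add; first exact: max_card.
by apply/subset_leq_card/fintype.subsetP => s; rewrite !inE andbC.
Qed.

Lemma ffact_ratio_cvg (R : realType) (z : nat -> nat) (r : nat) :
  (z n)%:R @[n --> \oo] --> (+oo : set_system R) ->
  (z n ^_ r)%:R / (z n)%:R ^+ r @[n --> \oo] --> (1 : R).
Proof.
move=> zoo.
have zpos : \forall n \near \oo, 0 < (z n)%:R :> R by exact: cvgry_gt zoo 0.
have zge : \forall n \near \oo, (r <= z n)%N.
  by near=> n; rewrite -(ler_nat R); near: n; exact: cvgry_ge zoo _.
have zinv : (z n)%:R^-1 @[n --> \oo] --> (0 : R) by exact/(gtr0_cvgV0 zpos).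
have prod1 : \prod_(i < r) (1 - i%:R * 0) = 1 :> R.
  by rewrite big1// => i _; rewrite mulr0 subr0.
(* Once [z n] is at least [r], the ratio is this product of a fixed number of factors, each tending
   to 1. *)
suff : \prod_(i < r) (1 - i%:R * (z n)%:R^-1) @[n --> \oo] -->
    \prod_(i < r) (1 - i%:R * 0 : R).
  rewrite prod1; apply: cvg_trans; apply: near_eq_cvg; near=> n.
  have zn0 : (z n)%:R != 0 :> R by rewrite gt_eqF//; near: n.
  rewrite ffact_prod natr_prod -[X in _ ^+ X]card_ord -prodr_const -prodf_div.
  apply: eq_bigr => i _; rewrite natrB.
    by rewrite mulrBl divff.
  by apply: leq_trans (ltnW (ltn_ord i)) _; near: n.
apply: cvg_prodr => i; apply: cvgB; first exact: cvg_cst.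
by apply: cvgM; [exact: cvg_cst|exact: zinv].
Unshelve. all: by end_near.
Qed.

(* Sampling with or without replacement only differs by the [z ^ r - z ^_ r]
   non-injective samples, a vanishing proportion of the [z ^ r] samples. *)
Lemma injective_samples_cvg (R : realType) (V : eqType) (x0 : V)
  (L : nat -> seq V) (r : nat) (u : 'I_r -> V) (q : 'I_r -> R) :
  (size (L n))%:R @[n --> \oo] --> (+oo : set_system R) ->
  (forall t, (count_mem (u t) (L n))%:R / (size (L n))%:R @[n --> \oo] --> q t) ->
  #|injective_samples x0 (L n) u|%:R / (size (L n) ^_ r)%:R @[n --> \oo] -->
    \prod_(t < r) q t.
Proof.
move=> zoo cq; pose z n := size (L n).
have zpos : \forall n \near \oo, 0 < (z n)%:R :> R by exact: cvgry_gt zoo 0.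
have ratio1 := ffact_ratio_cvg r zoo.
have prodq := cvg_prodr cq.
pose phi n : R := (z n ^_ r)%:R / (z n)%:R ^+ r.
have Gq : #|injective_samples x0 (L n) u|%:R / (z n)%:R ^+ r @[n --> \oo] -->
    \prod_(t < r) q t.
  apply: (squeeze_cvgr (f := fun n =>
    \prod_(t < r) ((count_mem (u t) (L n))%:R / (z n)%:R) - (1 - phi n)) _ _ prodq).
    near=> n.
    have zX : 0 < (z n)%:R ^+ r :> R by rewrite exprn_gt0//; near: n.
    have -> : \prod_(t < r) ((count_mem (u t) (L n))%:R / (z n)%:R) =
        (\prod_(t < r) count_mem (u t) (L n))%:R / (z n)%:R ^+ r :> R.
      by rewrite prodf_div -natr_prod prodr_const card_ord.
    rewrite ler_pM2r ?invr_gt0// ler_nat injective_samples_le andbT.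
    have one : (z n)%:R ^+ r / (z n)%:R ^+ r = 1 :> R by rewrite divff// gt_eqF.
    rewrite /phi -[X in X - _ / _]one -!mulrBl ler_pM2r ?invr_gt0// opprB addrA lerBlDr.
    by rewrite -natrX -!natrD ler_nat injective_samples_ge.
  have limE : \prod_(t < r) q t - (1 - 1) = \prod_(t < r) q t.
    by rewrite subrr subr0.
  by rewrite -limE; apply: cvgB => //; apply: cvgB => //; exact: cvg_cst.
(* Dividing by [phi], which tends to 1, replaces the power in the denominator by the falling
   factorial. *)
suff : #|injective_samples x0 (L n) u|%:R / (z n)%:R ^+ r / phi n
    @[n --> \oo] --> \prod_(t < r) q t / 1.
  rewrite divr1; apply: cvg_trans; apply: near_eq_cvg; near=> n.
  have zX : (z n)%:R ^+ r != 0 :> R.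
    by rewrite gt_eqF// exprn_gt0//; near: n.
  by rewrite /phi invfM invrK mulrA mulrAC mulfVK.
by apply: cvgM => //; apply: cvgV => //; exact: oner_neq0.
Unshelve. all: by end_near.
Qed.

(** * Probability of the reports given the history *)

(** Injections with the right values lie in the event, the other injections in its complement within
    [A]. Together they already exhaust the mass of [A], so both inclusions lose nothing, and samples
    that are not injections need no separate treatment. *)
Lemma uniform_injection_prob (R : realType) (d : measure_display)
  (T : measurableType d) (P : probability T R) (V : eqType) (x0 : V)
  (L : seq V) (r : nat) (u : 'I_r -> V) (S : T -> {ffun 'I_r -> nat})
  (A : set T) :
  measurable A -> (forall s, measurable (S @^-1` [set s])) ->
  (r <= size L)%N ->
  (forall s : {ffun 'I_r -> nat}, P (A `&` [set w | S w = s]) =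
    (P A * (if injectiveb s && [forall t, s t < size L]%N
            then ((size L ^_ r)%:R)^-1 else 0)%:E)%E) ->
  P ([set w | forall t, nth x0 L (S w t) = u t] `&` A) =
  ((#|injective_samples x0 L u|%:R / (size L ^_ r)%:R)%:E * P A)%E.
Proof.
move=> mA mS rL uniS; set E := [set w | _]; set m := (size L ^_ r)%:R : R.
have mS' w : measurable [set w' | S w' = S w] by exact: mS.
(* This is where [r <= size L] enters: injections exist. *)
have m0 : m != 0 by rewrite pnatr_eq0 -lt0n ffact_gt0.
pose ext (s : {ffun 'I_r -> 'I_(size L)}) : {ffun 'I_r -> nat} :=
  [ffun t => nat_of_ord (s t)].
have ext_inj : injective ext.
  move=> s s' /ffunP eqs; apply/ffunP => t; apply: val_inj.
  by have := eqs t; rewrite !ffunE.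
pose I := [set s : {ffun 'I_r -> 'I_(size L)} | injectiveb s]%SET.
have cardI : #|I| = size L ^_ r by rewrite card_inj_ffuns !card_ord.
pose B (Q : {set {ffun 'I_r -> 'I_(size L)}}) :=
  \bigcup_(s in [set` Q]) (A `&` [set w | S w = ext s]).
have mAs s : measurable (A `&` [set w | S w = s]).
  by apply: measurableI => //; exact: mS.
have mB Q : measurable (B Q).
  by apply: fin_bigcup_measurable => // s _; exact: mAs.
have PB (Q : {set {ffun 'I_r -> 'I_(size L)}}) : Q \subset I ->
    P (B Q) = ((#|Q|%:R / m)%:E * P A)%E.
  move=> /fintype.subsetP QI; rewrite measure_fin_bigcup//; last first.
    by move=> s s' _ _ [w [[_ /= ->] [_ /= /ext_inj]]].
  rewrite (_ : [set` Q] = [set` enum Q]); last first.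
    by apply/seteqP; split=> s /=; rewrite mem_enum.
  rewrite -fsbig_seq ?enum_uniq// big_enum /=.
  have PA : P A \is a fin_num by exact: fin_num_measure.
  rewrite (eq_bigr (fun=> ((fine (P A) / m)%:E))).
    by rewrite sumEFin sumr_const -(fineK PA) -EFinM; congr EFin;
      rewrite -mulr_natl; ring.
  move=> s /QI; rewrite inE => /injectiveP inj_s; rewrite uniS ifT.
    by rewrite -{1}(fineK PA) -EFinM.
  apply/andP; split; last by apply/forallP => t; rewrite ffunE.
  by apply/injectiveP => t t'; rewrite !ffunE => /val_inj/inj_s.
have mE : measurable E.
  by apply: (measurable_saturated mS') => w w' eqS; rewrite /E /= eqS.
pose G := injective_samples x0 L u.
have GI : G \subset I by apply/fintype.subsetP => s; rewrite !inE => /andP[].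
have BG : B G `<=` E `&` A.
  move=> w [s /= + [Aw /= Sw]]; rewrite inE => /andP[_ /forallP nth_s].
  by split=> // t; rewrite Sw ffunE; apply/eqP.
have BI : B (I :\: G) `<=` A `\` E.
  move=> w [s /= + [Aw /= Sw]]; rewrite !inE => /andP[notG inj_s].
  split=> // Ew; move: notG; rewrite inj_s /= => /negP; apply.
  by apply/forallP => t; apply/eqP; have := Ew t; rewrite Sw ffunE.
have leG : (P (B G) <= P (E `&` A))%E by rewrite le_measure ?inE//; exact: measurableI.
have leI : (P (B (I :\: G)) <= P (A `\` E))%E.
  by rewrite le_measure ?inE//; exact: measurableD.
have splitA : P A = (P (A `\` E) + P (E `&` A))%E.
  by rewrite setIC; exact: measureDI.
have splitB : (P (B (I :\: G)) + P (B G) = P A)%E.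
  have PA : P A \is a fin_num by exact: fin_num_measure.
  rewrite !PB ?subsetDl// -(fineK PA) -!EFinM -EFinD; congr EFin.
  have cardGI : (#|(I :\: G)%SET| + #|G| = size L ^_ r)%N.
    by rewrite -cardI -(cardsID G I) (finset.setIidPr GI) addnC.
  by rewrite -mulrDl -mulrDl -natrD cardGI divff// mul1r.
rewrite -/G -PB//; apply/eqP; rewrite eq_le leG andbT leNgt; apply/negP => ltG.
(* A strict loss in one inclusion could not be made up by the other, since both pairs of masses sum
   to [P A]. *)
have : (P A < P A)%E.
  rewrite -{1}splitB splitA; apply: lee_ltD => //.
  by apply: fin_num_measure.
by rewrite ltxx.
Qed.

Definition report_event (T : Type) (l r : nat) (j0 : 'I_l)
  (Y : nat -> 'I_l -> nat -> T -> vecN l) (sigma : nat -> T -> {ffun 'I_r -> nat})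
  (u : 'I_r -> vecN l) (n : nat) : set T :=
  [set w | forall t : 'I_r, sampled_report j0 Y sigma n t w = u t].

(* The conditional probability of the event given the history and, when fewer
   than [r] individuals are alive (where nothing is assumed on [sigma]), given
   the sample as well. *)
Definition cond_report_prob (R : realType) (T : Type) (l r : nat) (j0 : 'I_l)
  (Y : nat -> 'I_l -> nat -> T -> vecN l) (sigma : nat -> T -> {ffun 'I_r -> nat})
  (u : 'I_r -> vecN l) (n : nat) (w : T) : R :=
  let L := parent_reports j0 Y n w in
  if (r <= size L)%N
  then #|injective_samples (evec j0) L u|%:R / (size L ^_ r)%:R
  else \1_(report_event j0 Y sigma u n) w.

Arguments cond_report_prob {R T l r} j0 Y sigma u n w.

Lemma history_parent_reports (T : Type) (l : nat) (j0 : 'I_l)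
  (Y : nat -> 'I_l -> nat -> T -> vecN l) (n : nat) (w w' : T) :
  history j0 Y n.+1 w' = history j0 Y n.+1 w ->
  parent_reports j0 Y n.+1 w' = parent_reports j0 Y n.+1 w.
Proof. by move=> eqh; rewrite !parent_reportsS (history_generation eqh). Qed.

Lemma cond_report_prob_ge0 (R : realType) (T : Type) (l r : nat) (j0 : 'I_l)
  (Y : nat -> 'I_l -> nat -> T -> vecN l) (sigma : nat -> T -> {ffun 'I_r -> nat})
  (u : 'I_r -> vecN l) (n : nat) (w : T) :
  0 <= cond_report_prob j0 Y sigma u n w :> R.
Proof. by rewrite /cond_report_prob; case: ifP => _; rewrite ?divr_ge0. Qed.

Lemma cond_report_prob_le1 (R : realType) (T : Type) (l r : nat) (j0 : 'I_l)
  (Y : nat -> 'I_l -> nat -> T -> vecN l) (sigma : nat -> T -> {ffun 'I_r -> nat})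
  (u : 'I_r -> vecN l) (n : nat) (w : T) :
  cond_report_prob j0 Y sigma u n w <= 1 :> R.
Proof.
rewrite /cond_report_prob; case: ifP => [rL|_]; last first.
  by rewrite indicE lern1 leq_b1.
rewrite ler_pdivrMr ?ltr0n ?ffact_gt0// mul1r ler_nat.
set L := parent_reports _ _ _ _.
rewrite -[X in X ^_ _]card_ord -[X in _ ^_ X]card_ord -card_inj_ffuns.
by apply/subset_leq_card/fintype.subsetP => s; rewrite !inE => /andP[].
Qed.

Lemma measurable_history_sample (d : measure_display) (T : measurableType d)
  (l r : nat) (j0 : 'I_l) (Y : nat -> 'I_l -> nat -> T -> vecN l)
  (sigma : nat -> T -> {ffun 'I_r -> nat}) (n : nat) (w : T) :
  (forall n j i u, measurable (Y n j i @^-1` [set u])) ->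
  (forall n s, measurable (sigma n @^-1` [set s])) ->
  measurable [set w' | (history j0 Y n w', sigma n w') =
                       (history j0 Y n w, sigma n w)].
Proof.
move=> mY ms.
rewrite (_ : [set w' | _] = [set w' | history j0 Y n w' = history j0 Y n w] `&`
   sigma n @^-1` [set sigma n w]).
  by apply: measurableI; [exact: measurable_history|exact: ms].
by apply/seteqP; split=> w' /= [-> ->].
Qed.

Lemma report_event_sample (T : Type) (l r : nat) (j0 : 'I_l)
  (Y : nat -> 'I_l -> nat -> T -> vecN l) (sigma : nat -> T -> {ffun 'I_r -> nat})
  (u : 'I_r -> vecN l) (n : nat) (w w' : T) :
  (history j0 Y n.+1 w', sigma n.+1 w') = (history j0 Y n.+1 w, sigma n.+1 w) ->
  report_event j0 Y sigma u n.+1 w -> report_event j0 Y sigma u n.+1 w'.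
Proof.
move=> [eqh eqs] Ew t; have := Ew t; rewrite /sampled_report eqs.
by rewrite (history_parent_reports eqh).
Qed.

Lemma measurable_report_event (d : measure_display) (T : measurableType d)
  (l r : nat) (j0 : 'I_l) (Y : nat -> 'I_l -> nat -> T -> vecN l)
  (sigma : nat -> T -> {ffun 'I_r -> nat}) (u : 'I_r -> vecN l) (n : nat) :
  (forall n j i u, measurable (Y n j i @^-1` [set u])) ->
  (forall n s, measurable (sigma n @^-1` [set s])) ->
  measurable (report_event j0 Y sigma u n.+1).
Proof.
move=> mY ms; apply: (measurable_saturated
  (X := fun w => (history j0 Y n.+1 w, sigma n.+1 w))).
  by move=> w; exact: measurable_history_sample.
exact: report_event_sample.
Qed.

Lemma measurable_cond_report_prob (R : realType) (d : measure_display)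
  (T : measurableType d) (l r : nat) (j0 : 'I_l)
  (Y : nat -> 'I_l -> nat -> T -> vecN l)
  (sigma : nat -> T -> {ffun 'I_r -> nat}) (u : 'I_r -> vecN l) (n : nat) :
  (forall n j i u, measurable (Y n j i @^-1` [set u])) ->
  (forall n s, measurable (sigma n @^-1` [set s])) ->
  measurable_fun setT (cond_report_prob j0 Y sigma u n.+1 : T -> R).
Proof.
move=> mY ms; apply: (measurable_fun_factor
  (X := fun w => (history j0 Y n.+1 w, sigma n.+1 w))).
  by move=> w; exact: measurable_history_sample.
move=> w w' eqX; have [eqh _] := eqX.
rewrite /cond_report_prob (history_parent_reports eqh); case: ifP => // _.
rewrite !indicE; congr (_ %:R); congr nat_of_bool.
by apply/idP/idP; rewrite !inE; apply: report_event_sample.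
Qed.

(** The two integrands have equal integrals over each fiber of the history: on a short list they
    coincide, otherwise the sample is a uniform injection into a fixed list. *)
Lemma report_event_prob (R : realType) (d : measure_display)
  (T : measurableType d) (P : probability T R) (l r : nat) (j0 : 'I_l)
  (Y : nat -> 'I_l -> nat -> T -> vecN l)
  (sigma : nat -> T -> {ffun 'I_r -> nat}) (u : 'I_r -> vecN l) (n : nat) :
  (forall n j i u, measurable (Y n j i @^-1` [set u])) ->
  (forall n s, measurable (sigma n @^-1` [set s])) ->
  uniform_sampling P j0 Y sigma ->
  P (report_event j0 Y sigma u n.+1) =
  (\int[P]_w (cond_report_prob j0 Y sigma u n.+1 w)%:E)%E.
Proof.
move=> mY ms unif; set E := report_event _ _ _ _ _.
have mE : measurable E by exact: measurable_report_event.
have mH w : measurable [set w' | history j0 Y n.+1 w' = history j0 Y n.+1 w].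
  exact: measurable_history.
have mcond : measurable_fun setT
    (fun w => (cond_report_prob j0 Y sigma u n.+1 w)%:E : \bar R).
  by apply/measurable_EFinP; exact: measurable_cond_report_prob.
have mind : measurable_fun setT (fun w => (\1_E w)%:E : \bar R).
  by apply/measurable_EFinP; exact: measurable_indic.
have cond0 w : (0 <= (cond_report_prob j0 Y sigma u n.+1 w)%:E :> \bar R)%E.
  by rewrite lee_fin cond_report_prob_ge0.
have ind0 w : (0 <= (\1_E w)%:E :> \bar R)%E by rewrite lee_fin.
have -> : P E = (\int[P]_w (\1_E w)%:E)%E.
  by rewrite integral_indic// setIT.
suff eqfib w : (\int[P]_(x in [set w' | history j0 Y n.+1 w' = history j0 Y n.+1 w])
      (\1_E x)%:E =
    \int[P]_(x in [set w' | history j0 Y n.+1 w' = history j0 Y n.+1 w])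
      (cond_report_prob j0 Y sigma u n.+1 x)%:E)%E.
  by apply/eqP; rewrite eq_le; apply/andP; split;
    apply: (ge0_le_integral_fibers (X := history j0 Y n.+1)) => // w;
    rewrite eqfib.
set A := [set w' | _]; set L := parent_reports j0 Y n.+1 w.
have mA : measurable A by exact: mH.
have AL x : A x -> parent_reports j0 Y n.+1 x = L.
  exact: history_parent_reports.
have [rL|Lr] := leqP r (size L); last first.
  apply: eq_integral => x; rewrite inE => /AL Lx.
  by rewrite /cond_report_prob Lx leqNgt Lr.
(* The population size is already constant on the fiber; it is added to match the form of the events
   in [uniform_sampling]. *)
have AZ : A = Y_cylinder Y (history j0 Y n.+1 w) `&`
    [set w' | vnorm (GW_Z j0 Y n.+1 w') = size L].
  rewrite -history_fiber; apply/seteqP; split=> x /=; last by case.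
  by move=> Ax; split=> //; rewrite -(AL x Ax) size_parent_reports.
have uniS s : P (A `&` [set w' | sigma n.+1 w' = s]) =
    (P A * (if injectiveb s && [forall t, s t < size L]%N
            then ((size L ^_ r)%:R)^-1 else 0)%:E)%E.
  by rewrite AZ; apply: unif => //; exact: history_ltn.
have EA : E `&` A =
    [set w' | forall t, nth (evec j0) L (sigma n.+1 w' t) = u t] `&` A.
  apply/seteqP; split=> x [Ex Ax]; split=> // t; have := Ex t;
    by rewrite /sampled_report (AL x Ax).
transitivity (P (E `&` A)); first exact: integral_indic.
rewrite EA (uniform_injection_prob (evec j0) u mA (ms n.+1) rL uniS).
rewrite (_ : (\int[P]_(x in A) _ = \int[P]_(x in A) cst
   ((#|injective_samples (evec j0) L u|%:R / (size L ^_ r)%:R)%:E) x)%E).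
  by rewrite integral_cst.
apply: eq_integral => x; rewrite inE => /AL Lx.
by rewrite /cond_report_prob Lx rL.
Qed.

(** * Convergence of the joint law of the reports *)

Theorem theorem4p1
  (R : realType) (d : measure_display) (T : measurableType d)
  (P : probability T R)
  (l : nat) (p : 'I_l -> vecN l -> R) (j0 : 'I_l)
  (Y : nat -> 'I_l -> nat -> T -> vecN l)
  (r : nat) (sigma : nat -> T -> {ffun 'I_r -> nat})
  (rho : R) (b : 'rV[R]_l) (C K : R) (W : T -> R) :
  (2 <= l)%N ->
  (1 <= r)%N ->
  (* offspring laws *)
  (forall j, is_pmf (p j)) ->
  (* model: measurability, laws, independence, sampling *)
  (forall n j i u, measurable (Y n j i @^-1` [set u])) ->
  (forall n s, measurable (sigma n @^-1` [set s])) ->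
  (forall n j i u, P (Y n j i @^-1` [set u]) = (p j u)%:E) ->
  Y_mutually_independent P Y ->
  uniform_sampling P j0 Y sigma ->
  (* A1 *)
  (forall j, p j [ffun _ => 0%N] = 0 /\ \sum_(k < l) p j (evec k) < 1) ->
  (* A2 *)
  positively_regular (mean_matrix p) ->
  (forall lam, eigenvalue (mean_matrix p) lam -> lam <= rho) ->
  (forall i, 0 <= b 0 i) -> \sum_(i < l) b 0 i = 1 ->
  b *m mean_matrix p = rho *: b ->
  1 < rho ->
  (* A3 (ii), (iii) ; (i) holds trivially since r_n = r is constant *)
  (forall i, (\esum_(u in [set: vecN l]) (p i u * ((vnorm u)%:R ^+ 2))%:E
               <= C%:E)%E) ->
  (forall i, (\esum_(u in [set: vecN l]) (p i u * ((vnorm u)%:R)^-1)%:E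
               <= K%:E)%E) ->
  (* Kesten-Stigum: Z_n rho^-n -> b W a.s., with W > 0 a.s. *)
  {ae P, forall w, 0 < W w /\
     forall k : 'I_l,
       (fun n => (GW_Z j0 Y n w k)%:R / rho ^+ n) @ \oo --> b 0 k * W w} ->
  forall u : 'I_r -> vecN l,
    (fun n => P [set w | forall t : 'I_r, sampled_report j0 Y sigma n t w = u t])
      @ \oo --> (\prod_(t < r) size_biased p rho b (u t))%:E.
Proof.
move=> _ _ _ mY ms lawY indY unif _ _ _ _ b1 _ rho1 _ _ KS u.
(* Generation 0 has no parents to report, so the sequence is started at generation 1. *)
rewrite -cvg_shiftS.
set q := \prod_(t < r) _.
have rho0 : 0 < rho by exact: lt_trans rho1.
have dev : {ae P, forall w (k : 'I_l * 'I_r), deviation j0 p Y n k.1 (u k.2) w ^+ 2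
    / (GW_Z j0 Y n w k.1).+1%:R / rho ^+ n @[n --> \oo] --> 0}.
  (* There are finitely many pairs of a type and a sampled rank, so one null set serves them all. *)
  apply: filter_forall => k; exact: deviation_cvg0.
have cvgE : {ae P, forall w,
    (cond_report_prob j0 Y sigma u n.+1 w)%:E @[n --> \oo] --> q%:E}.
  apply: filterS2 KS dev => w [W0 ZW] devw.
  apply: cvg_EFin; first by near=> n.
  have Zoo := cvg_vnorm_pinfty rho1 W0 (cvg_vnorm_rate b1 ZW).
  have ZSoo : (vnorm (GW_Z j0 Y n.+1 w))%:R @[n --> \oo] --> (+oo : set_system R).
    by move: Zoo; rewrite -cvg_shiftS.
  have Loo : (size (parent_reports j0 Y n.+1 w))%:R @[n --> \oo]
      --> (+oo : set_system R).
    by under eq_fun => n do rewrite size_parent_reports.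
  have freq t : (count_mem (u t) (parent_reports j0 Y n.+1 w))%:R /
      (size (parent_reports j0 Y n.+1 w))%:R @[n --> \oo]
      --> size_biased p rho b (u t).
    under eq_fun => n do rewrite size_parent_reports.
    apply: report_frequency_cvg rho1 W0 b1 _ ZW => j.
    exact: (devw (j, t)).
  have := injective_samples_cvg (evec j0) Loo freq.
  (* The list eventually has at least [r] entries, and [cond_report_prob] is then the proportion of
     injections. *)
  apply: cvg_trans; apply: near_eq_cvg; near=> n.
  have rL : (r <= size (parent_reports j0 Y n.+1 w))%N.
    by rewrite -(ler_nat R); near: n; exact: cvgry_ge Loo _.
  rewrite -[RHS]/(cond_report_prob j0 Y sigma u n.+1 w).
  by rewrite /cond_report_prob rL.
have -> : (fun n => P [set w | forall t : 'I_r, sampled_report j0 Y sigma n.+1 t w = u t])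
    = (fun n => \int[P]_w (cond_report_prob j0 Y sigma u n.+1 w)%:E)%E.
  by apply/funext => n; exact: report_event_prob.
have intq : (\int[P]_w cst q%:E w = q%:E)%E.
  rewrite integral_cst// -[RHS]mule1; congr (_ * _)%E; exact: probability_setT.
(* Conditional probabilities are dominated by the constant 1, which is integrable for a
   probability. *)
have [|||||_ _] := @dominated_convergence _ _ _ P setT measurableT
  (fun n w => (cond_report_prob j0 Y sigma u n.+1 w)%:E) (cst q%:E) (cst 1%E).
- by move=> n; apply/measurable_EFinP; exact: measurable_cond_report_prob.
- exact: measurable_cst.
- by apply: filterS cvgE => w cw _.
- exact: (finite_measure_integrable_cst P 1).
- apply/aeW => w n _; rewrite gee0_abs ?lee_fin ?cond_report_prob_ge0//.
  exact: cond_report_prob_le1.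
by rewrite intq.
Unshelve. all: by end_near.
Qed.
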